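(* If $G$ is a cubic Halin graph, then $\chi'_{st}(G) \leq 6$.
   Context: A Halin graph is a planar graph $G = T \cup C$ obtained from a plane tree $T$ with no vertices of degree $2$ and at least four vertices, by adding a cycle $C$ through all leaves of $T$ in the cyclic order given by the plane embedding. A graph is cubic if every vertex has degree $3$. A star edge coloring of a graph is a proper edge coloring in which there is no path or cycle of length four (i.e., with four edges) whose edges use only two colors. The star chromatic index $\chi'_{st}(G)$ is the minimum number $t$ such that $G$ has a star edge coloring with $t$ colors. *)

(* Defs.v *)
From mathcomp Require Import all_boot perm.
Set Implicit Arguments.
Unset Strict Implicit.
Unset Printing Implicit Defensive.

Record sgraph := SGraph {
  vertex :> finType;
  adj : rel vertex;
  adj_sym : symmetric adj;
  adj_irrefl : irreflexive adj }.

Definition neighbours (V : finType) (e : rel V) (x : V) : {set V} :=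
  [set y | e x y].

Definition degree (V : finType) (e : rel V) (x : V) : nat := #|neighbours e x|.

Definition cubic (G : sgraph) : Prop := forall x : G, degree (@adj G) x = 3.

Section StarEdgeColoring.

Variable G : sgraph.

Definition edge_set : {set {set G}} :=
  [set [set p.1; p.2] | p : G * G & adj p.1 p.2].

Definition edge : finType := {e : {set G} | e \in edge_set}.

Definition proper_coloring k (c : {ffun edge -> 'I_k}) : bool :=
  [forall e : edge, forall f : edge,
    (e != f) && (val e :&: val f != set0) ==> (c e != c f)].

Definition is_path4 (e1 e2 e3 e4 : edge) : bool :=
  [exists x0 : G, exists x1 : G, exists x2 : G, exists x3 : G, exists x4 : G,
    uniq [:: x0; x1; x2; x3; x4] &&
    [&& val e1 == [set x0; x1], val e2 == [set x1; x2],
        val e3 == [set x2; x3] & val e4 == [set x3; x4]]].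

Definition is_cycle4 (e1 e2 e3 e4 : edge) : bool :=
  [exists x0 : G, exists x1 : G, exists x2 : G, exists x3 : G,
    uniq [:: x0; x1; x2; x3] &&
    [&& val e1 == [set x0; x1], val e2 == [set x1; x2],
        val e3 == [set x2; x3] & val e4 == [set x3; x0]]].

Definition star_edge_coloring k (c : {ffun edge -> 'I_k}) : bool :=
  proper_coloring c &&
  [forall e1 : edge, forall e2 : edge, forall e3 : edge, forall e4 : edge,
    is_path4 e1 e2 e3 e4 || is_cycle4 e1 e2 e3 e4 ==>
    ~~ (#|[set c e1; c e2; c e3; c e4]| <= 2)].

Definition star_edge_colorable (k : nat) : bool :=
  [exists c : {ffun edge -> 'I_k}, star_edge_coloring c].

Lemma star_edge_colorable_ex : exists k, star_edge_colorable k.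
Proof.
exists #|edge|; apply/existsP; exists [ffun e => enum_rank e].
have cE e : [ffun e : edge => enum_rank e] e = enum_rank e by rewrite ffunE.
apply/andP; split.
  apply/forallP => e; apply/forallP => f; apply/implyP => /andP[nef _].
  by rewrite !cE (inj_eq enum_rank_inj).
apply/forallP => e1; apply/forallP => e2; apply/forallP => e3.
apply/forallP => e4; apply/implyP => H.
have [x0 [x1 [x2 [x3 [U E1 E2 E3]]]]] : exists x0 x1 x2 x3 : G,
    [/\ uniq [:: x0; x1; x2; x3], val e1 = [set x0; x1],
        val e2 = [set x1; x2] & val e3 = [set x2; x3]].
  case/orP: H => /existsP[x0 /existsP[x1 /existsP[x2 /existsP[x3]]]].
    case/existsP => x4 /andP[U /and4P[/eqP E1 /eqP E2 /eqP E3 _]].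
    exists x0, x1, x2, x3; split=> //.
    exact: (subseq_uniq (prefix_subseq [:: x0; x1; x2; x3] [:: x4]) U).
  case/andP => U /and4P[/eqP E1 /eqP E2 /eqP E3 _].
  by exists x0, x1, x2, x3.
move: U; rewrite /= !inE !negb_or => /and4P[/and3P[n01 n02 n03] /andP[n12 n13] n23 _].
have d12 : e1 != e2.
  apply/eqP => E; have: x0 \in val e2 by rewrite -E E1 !inE eqxx.
  by rewrite E2 !inE (negPf n01) (negPf n02).
have d13 : e1 != e3.
  apply/eqP => E; have: x0 \in val e3 by rewrite -E E1 !inE eqxx.
  by rewrite E3 !inE (negPf n02) (negPf n03).
have d23 : e2 != e3.
  apply/eqP => E; have: x1 \in val e3 by rewrite -E E2 !inE eqxx.
  by rewrite E3 !inE (negPf n12) (negPf n13).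
rewrite -ltnNge !cE.
have -> : 3 = #|[set enum_rank e1; enum_rank e2; enum_rank e3]|.
  by rewrite setUC cardsU1 cards2 !inE !(inj_eq enum_rank_inj)
    (eq_sym e3) (eq_sym e3) negb_or d13 d23 d12.
exact/subset_leq_card/subsetUl.
Qed.

Definition star_chromatic_index : nat := ex_minn star_edge_colorable_ex.

End StarEdgeColoring.

Section PlaneTree.

Variables (V : finType) (t : rel V).

Definition is_tree : Prop :=
  [/\ symmetric t, irreflexive t, forall x y, connect t x y
    & forall c : seq V, 2 < size c -> ~ ucycle t c].

Definition leaf : pred V := [pred x | degree t x == 1].

(* A plane embedding of a graph is given combinatorially by a rotation system:
   [rot x] is the cyclic order of the neighbours of [x] around [x] (its values
   away from the neighbours of [x] are irrelevant). For a tree every rotation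
   system is that of a plane embedding. *)
Definition rotation_system (rot : V -> {perm V}) : Prop :=
  forall x y, t x y -> porbit (rot x) y = neighbours t x.

(* One step of the walk along the boundary of a face: having traversed the
   directed edge from [d.1] to [d.2], leave [d.2] along the next edge. *)
Definition face_step (rot : V -> {perm V}) (d : V * V) : V * V :=
  (d.2, rot d.2 d.1).

(* A plane tree has a single face, whose boundary walk traverses each edge once
   in each direction, hence leaves each leaf exactly once: listing the leaves
   along the walk gives their cyclic order in the embedding. The directed edge
   [d] only fixes where the walk starts. *)
Definition leaf_order (rot : V -> {perm V}) (d : V * V) : seq V :=
  [seq x <- map fst (orbit (face_step rot) d) | leaf x].

End PlaneTree.

Definition cycle_adj (V : finType) (c : seq V) : rel V :=
  fun x y => [&& x \in c, y \in c & (next c x == y) || (next c y == x)].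

Definition halin (G : sgraph) : Prop :=
  exists (t : rel G) (rot : G -> {perm G}) (d : G * G),
    [/\ is_tree t, rotation_system t rot & t d.1 d.2] /\
    [/\ 4 <= #|G|, forall x, degree t x <> 2
      & forall x y, adj x y = t x y || cycle_adj (leaf_order t rot d) x y].

(* Main.v *)
From HB Require Import structures.
Require Import Defs.
From mathcomp Require Import all_boot perm.
Set Implicit Arguments.
Unset Strict Implicit.
Unset Printing Implicit Defensive.

(* Cutting a tree edge of a cubic Halin graph separates a piece (a "pole") that
   hangs on three edges: the tree edge, and the two edges of the outer cycle
   leaving the first and the last leaf of the piece. For a partial colouring of
   the piece, what the rest of the graph sees at such a dangling edge [uv], with
   [v] in the piece, is its colour, the colours of the other edges at [v], and
   those of the latter that can be followed by a second edge of the colour of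
   [uv]; a bicoloured path or cycle with four edges crosses between two pieces
   only if such a "return" on one side meets an edge of the same colour on the
   other side. These data for the three dangling edges form a "state". There is
   a list of nine states such that every piece with at least three leaves
   realizes each of them, for every permutation of the six colours; pieces with
   one or two leaves have lists of their own. A finite computation shows that
   each state listed for a piece results from joining a new vertex to suitable
   listed states of its two sub-pieces, and that the two sides of any tree edge
   have listed states that fit together. *)

(** * States and their composition *)

(* [vadj] and [vflag] are only upper bounds: every condition below forbids
   coincidences, so it is monotone in them. *)
Record view := View { vcol : nat; vadj : seq nat; vflag : seq nat }.
Record state := State { stem : view; left : view; right : view }.

Lemma viewK :
  cancel (fun v => (vcol v, vadj v, vflag v)) (fun t => View t.1.1 t.1.2 t.2).
Proof. by case. Qed.
HB.instance Definition _ := Equality.copy view (can_type viewK).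

Lemma stateK :
  cancel (fun u => (stem u, left u, right u)) (fun t => State t.1.1 t.1.2 t.2).
Proof. by case. Qed.
HB.instance Definition _ := Equality.copy state (can_type stateK).

Definition le_view (v w : view) : bool :=
  [&& vcol v == vcol w, all (mem (vadj w)) (vadj v)
    & all (mem (vflag w)) (vflag v)].

(** The views show one edge from its two sides. A flag of one side occurring among the colours of
    the other would allow a bicoloured walk across the edge. *)
Definition compat (v w : view) : bool :=
  [&& vcol v == vcol w, ~~ has (mem (vadj w)) (vflag v)
    & ~~ has (mem (vadj v)) (vflag w)].

(** A pair [(k, X)] stands for another edge at the same vertex, of colour [k], whose far end shows
    colours within [X]; a return through it needs the colour of the view there. *)
Definition add_flags (v : view) (s : seq (nat * seq nat)) : view :=
  View (vcol v) (vadj v)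
    (vflag v ++ [seq cX.1 | cX <- s & vcol v \in cX.2]).

(* [b] tells that the piece is a single vertex: its other two dangling edges
   may become internal edges after a join and then contribute returns. [Xp], [Xa], [Xb]
   bound the colours at the outer ends of the three edges; [::] stands for an
   outer end that remains outside. *)
Definition extend (b : bool) (u : state) (Xp Xa Xb : seq nat) : state :=
  let P := (vcol (stem u), Xp) in
  let L := (vcol (left u), Xa) in
  let R := (vcol (right u), Xb) in
  if b then State (add_flags (stem u) [:: L; R]) (add_flags (left u) [:: P; R])
                  (add_flags (right u) [:: P; L])
  else u.

(** No flags at first: a return passes through the outer end of another of the three edges, and
    [extend true] adds it once that end lies inside. *)
Definition vertex_state (p a b : nat) : state :=
  State (View p [:: a; b] [::]) (View a [:: p; b] [::]) (View b [:: p; a] [::]).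

(** Both pieces hang at a new vertex, [u1] to the left, so the right edge of [u1] is the left edge
    of [u2]. This edge and the two stems become internal and must be compatible; the new stem and
    the two outermost edges stay dangling and must be bounded by the views of [u]. *)
Definition node_check (b1 b2 : bool) (u1 u2 u : state) : bool :=
  let p := vcol (stem u) in
  let p1 := vcol (stem u1) in
  let p2 := vcol (stem u2) in
  let ey := extend true (vertex_state p p1 p2)
              [::] (vadj (stem u1)) (vadj (stem u2)) in
  let e1 := extend b1 u1 [:: p; p2] [::] (vadj (left u2)) in
  let e2 := extend b2 u2 [:: p; p1] (vadj (right u1)) [::] in
  [&& p < 6, uniq [:: p; p1; p2], compat (right e1) (left e2),
      compat (left ey) (stem e1), compat (right ey) (stem e2),
      le_view (stem ey) (stem u), le_view (left e1) (left u)
    & le_view (right e2) (right u)].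

(** The pieces face each other across a common stem, so the left edge of one is the right edge of
    the other. *)
Definition close_check (b1 b2 : bool) (u1 u2 : state) : bool :=
  let e1 := extend b1 u1 (vadj (stem u2)) (vadj (right u2)) (vadj (left u2)) in
  let e2 := extend b2 u2 (vadj (stem u1)) (vadj (right u1)) (vadj (left u1)) in
  [&& compat (stem e1) (stem e2), compat (left e1) (right e2)
    & compat (right e1) (left e2)].

Definition recolor_view (s : seq nat) (v : view) : view :=
  View (nth 0 s (vcol v)) (map (nth 0 s) (vadj v)) (map (nth 0 s) (vflag v)).

Definition recolor (s : seq nat) (u : state) : state :=
  State (recolor_view s (stem u)) (recolor_view s (left u))
        (recolor_view s (right u)).

(* Both lists were found by computer search: the greatest set of states
   satisfying [states_closed], thinned out greedily. *)
Definition cherry_states := [::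
  State (View 0 [:: 1; 2] [::]) (View 1 [:: 2; 3] [:: 2; 3]) (View 4 [:: 1; 3] [::]);
  State (View 0 [:: 1; 2] [::]) (View 3 [:: 1; 4] [::]) (View 5 [:: 2; 4] [::]);
  State (View 0 [:: 1; 2] [::]) (View 3 [:: 1; 4] [:: 4]) (View 3 [:: 2; 4] [:: 4]);
  State (View 0 [:: 1; 2] [:: 1]) (View 0 [:: 1; 3] [:: 1]) (View 4 [:: 2; 3] [::]);
  State (View 0 [:: 1; 2] [:: 1; 2]) (View 3 [:: 0; 1] [::]) (View 4 [:: 0; 2] [::]);
  State (View 0 [:: 1; 2] [:: 1; 2]) (View 3 [:: 0; 1] [:: 0]) (View 3 [:: 0; 2] [:: 0])].
Definition large_states := [::
  State (View 0 [:: 1; 2] [::]) (View 3 [:: 1; 4] [:: 1; 4]) (View 4 [:: 1; 5] [:: 5]);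
  State (View 0 [:: 1; 2] [:: 1]) (View 1 [:: 2; 3] [:: 2; 3]) (View 4 [:: 2; 5] [::]);
  State (View 0 [:: 1; 2] [:: 1]) (View 3 [:: 0; 1] [:: 0; 1]) (View 3 [:: 1; 4] [:: 1; 4]);
  State (View 0 [:: 1; 2] [:: 1]) (View 3 [:: 0; 1] [:: 0; 1]) (View 4 [:: 1; 5] [:: 1; 5]);
  State (View 0 [:: 1; 2] [:: 1]) (View 3 [:: 2; 4] [:: 2; 4]) (View 3 [:: 2; 5] [::]);
  State (View 0 [:: 1; 2] [:: 1; 2]) (View 0 [:: 1; 3] [:: 1; 3]) (View 4 [:: 1; 5] [:: 1; 5]);
  State (View 0 [:: 1; 2] [:: 1; 2]) (View 3 [:: 0; 1] [:: 0; 1]) (View 0 [:: 1; 4] [:: 1; 4]);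
  State (View 0 [:: 1; 2] [:: 1; 2]) (View 3 [:: 1; 4] [:: 1; 4]) (View 3 [:: 0; 1] [::]);
  State (View 0 [:: 1; 2] [:: 1; 2]) (View 3 [:: 1; 4] [:: 1; 4]) (View 5 [:: 0; 1] [:: 1])].

(** Here [n] counts leaves. The list is constant from three leaves on, which leaves finitely many
    cases to check. *)
Definition base_states (n : nat) : seq state :=
  match n with
  | 0 | 1 => [:: vertex_state 0 1 2]
  | 2 => cherry_states
  | _ => large_states
  end.

Definition all_states (n : nat) : seq state :=
  [seq recolor s u | s <- permutations (iota 0 6), u <- base_states n].

(* The filters only prune the search: [node_check] implies them. *)
Definition node_closed (n1 n2 : nat) : bool :=
  all (fun u =>
    let fits v u' w :=
      le_view (View (vcol v) (vadj v) [::]) w &&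
      (vcol (stem u') \in vadj (stem u)) in
    let c1 := [seq u1 <- all_states n1 | fits (left u1) u1 (left u)] in
    let c2 := [seq u2 <- all_states n2 | fits (right u2) u2 (right u)] in
    has (fun u1 => has (fun u2 => node_check (n1 == 1) (n2 == 1) u1 u2 u) c2) c1)
  (base_states (n1 + n2)).

(** Permuting the colours on both sides at once allows [u1] to be taken from the base list. *)
Definition closing_pair (n1 n2 : nat) : bool :=
  has (fun u1 => has (fun u2 => close_check (n1 == 1) (n2 == 1) u1 u2) (all_states n2))
    (base_states n1).

(** The value 3 stands for three or more leaves. For [(1, 1)] no closing is asked: two single
    vertices would form a tree with one edge. *)
Definition states_closed : bool :=
  all (fun n => node_closed n.1 n.2 && ((n == (1, 1)) || closing_pair n.1 n.2))
    [seq (n1, n2) | n1 <- [:: 1; 2; 3], n2 <- [:: 1; 2; 3]].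

Lemma states_closedT : states_closed. Proof. by vm_compute. Qed.

Lemma base_states_cap n : base_states (minn n 3) = base_states n.
Proof. by case: n => [|[|[|[|n]]]]. Qed.

Lemma base_states_cap2 n1 n2 : 0 < n1 -> 0 < n2 ->
  base_states (minn n1 3 + minn n2 3) = base_states (n1 + n2).
Proof. by case: n1 => [|[|[|[|n1]]]] // _; case: n2 => [|[|[|[|n2]]]]. Qed.

Lemma states_closed_cap n1 n2 : 0 < n1 -> 0 < n2 ->
  node_closed (minn n1 3) (minn n2 3) &&
  (((minn n1 3, minn n2 3) == (1, 1)) || closing_pair (minn n1 3) (minn n2 3)).
Proof.
move=> h1 h2; have /allP/(_ (minn n1 3, minn n2 3)) := states_closedT; apply.
by case: n1 h1 => [|[|[|[|n1]]]] // _; case: n2 h2 => [|[|[|[|n2]]]].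
Qed.

Lemma node_states n1 n2 u : 0 < n1 -> 0 < n2 -> u \in base_states (n1 + n2) ->
  exists u1 u2, [/\ u1 \in all_states n1, u2 \in all_states n2
    & node_check (n1 == 1) (n2 == 1) u1 u2 u].
Proof.
move=> h1 h2; rewrite -base_states_cap2 // => hu.
have /andP[/allP H _] := states_closed_cap h1 h2.
have /hasP[u1] := H u hu; rewrite mem_filter => /andP[_ m1].
case/hasP=> u2; rewrite mem_filter => /andP[_ m2] h.
have E n : 0 < n -> (minn n 3 == 1) = (n == 1) by case: n => [|[|[|[|n]]]].
by exists u1, u2; move: h m1 m2; rewrite /all_states !base_states_cap !E.
Qed.

Lemma close_states n1 n2 : 0 < n1 -> 0 < n2 -> 2 < n1 + n2 ->
  exists u1 u2, [/\ u1 \in base_states n1, u2 \in all_states n2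
    & close_check (n1 == 1) (n2 == 1) u1 u2].
Proof.
move=> h1 h2 h3; have /andP[_ /orP[/eqP[] |]] := states_closed_cap h1 h2.
  by case: n1 h1 h3 => [|[|[|[|n1]]]] //; case: n2 h2 => [|[|[|[|n2]]]].
case/hasP=> u1; rewrite base_states_cap => m1 /hasP[u2 m2 h].
have E n : 0 < n -> (minn n 3 == 1) = (n == 1) by case: n => [|[|[|[|n]]]].
by exists u1, u2; move: h m2; rewrite /all_states !base_states_cap !E.
Qed.

(** * Partial colourings of pieces *)

Section Poles.

Variables (V : finType) (e : rel V).
Hypotheses (e_sym : symmetric e) (e_irr : irreflexive e).

(** Colours are given to all ordered pairs, edges or not, so that colourings of two pieces can be
    merged by a plain case distinction. *)
Definition coloring (c : V -> V -> nat) : Prop :=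
  (forall u v, c u v = c v u) /\ (forall u v, c u v < 6).

(** Only inner vertices of the walk need to lie in [A], here as in [star_on]; dangling edges are
    thereby included. *)
Definition proper_on (A : {set V}) (c : V -> V -> nat) : Prop :=
  forall u v w, v \in A -> e u v -> e v w -> u != w -> c u v != c v w.

(* [x4 = x0] is allowed, so that 4-cycles are covered. *)
Definition star_on (A : {set V}) (c : V -> V -> nat) : Prop :=
  forall x0 x1 x2 x3 x4, x1 \in A -> x2 \in A -> x3 \in A ->
    e x0 x1 -> e x1 x2 -> e x2 x3 -> e x3 x4 ->
    x0 != x2 -> x1 != x3 -> x2 != x4 ->
    c x0 x1 = c x2 x3 -> c x1 x2 <> c x3 x4.

(** The dart [d] points into the piece. The middle vertex [z] of a return must lie in [A], its end
    [s] need not; hence enlarging [A] may create returns. *)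
Definition view_ok (A : {set V}) (c : V -> V -> nat) (d : V * V) (f : view) :=
  [/\ c d.1 d.2 = vcol f,
      forall z, e d.2 z -> z != d.1 -> c d.2 z \in vadj f
    & forall z s, z \in A -> e d.2 z -> z != d.1 -> e z s -> s != d.2 ->
        c z s = vcol f -> c d.2 z \in vflag f].

(* No bicoloured walk [z0 - d.1 - d.2 - z - s]. *)
Definition no_return (A : {set V}) (c : V -> V -> nat) (d : V * V) : Prop :=
  forall z0 z s, z \in A -> e d.2 z -> z != d.1 -> e z s -> s != d.2 ->
    e d.1 z0 -> z0 != d.2 -> c d.1 z0 = c d.2 z -> c z s <> c d.1 d.2.

Definition swap (d : V * V) := (d.2, d.1).

Lemma view_le A c d f g : le_view f g -> view_ok A c d f -> view_ok A c d g.
Proof.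
case/and3P=> /eqP E /allP Ha /allP Hf [H1 H2 H3].
split; [by rewrite -E | by move=> z ez nz; exact: Ha (H2 z ez nz) |].
by move=> z s zA ez nz es ns; rewrite -E => h; exact: Hf (H3 z s zA ez nz es ns h).
Qed.

(** A bicoloured walk across [d] makes the colour of its edge after [d] a flag on one side and an
    adjacent colour on the other. *)
Lemma compat_no_return A c d f g : coloring c -> compat f g ->
  view_ok A c d f -> view_ok A c (swap d) g ->
  no_return A c d /\ no_return A c (swap d).
Proof.
case=> csym _ /and3P[/eqP E /hasPn H1 /hasPn H2] [F1 F2 F3] [G1 G2 G3].
split=> z0 z s zA ez nz es ns e0 n0 /= Ec Ed.
  have h : c d.2 z \in vflag f by apply: (F3 z s) => //; rewrite Ed.
  by case/negP: (H1 _ h); rewrite -Ec; apply: G2.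
have h : c d.1 z \in vflag g by apply: (G3 z s) => //; rewrite Ed.
by case/negP: (H2 _ h); rewrite -Ec; apply: F2.
Qed.

(** If the three inner vertices of a bicoloured walk are not all in one part, its second or third
    edge joins two parts, and the walk, possibly reversed, is a return across that edge. *)
Lemma star_on_parts (A : {set V}) c (P : V -> nat) : coloring c ->
  (forall i, star_on [set v in A | P v == i] c) ->
  (forall v w, v \in A -> w \in A -> e v w -> P v != P w ->
     no_return A c (v, w)) ->
  star_on A c.
Proof.
case=> csym _ Hi Hc x0 x1 x2 x3 x4 A1 A2 A3 e0 e1 e2 e3 n0 n1 n2 E1 E2.
case: (eqVneq (P x1) (P x2)) => [E12|N12]; last first.
  apply: (Hc _ _ A1 A2 e1 N12 x0 x3 x4) => //=; rewrite 1?e_sym // 1?eq_sym //.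
  by rewrite csym.
case: (eqVneq (P x2) (P x3)) => [E23|N23]; last first.
  have e2' : e x3 x2 by rewrite e_sym.
  have N32 : P x3 != P x2 by rewrite eq_sym.
  apply: (Hc _ _ A3 A2 e2' N32 x4 x1 x0) => //=; rewrite 1?e_sym // 1?eq_sym //.
    by rewrite -E2 csym.
  by rewrite csym E1 csym.
by apply: (Hi (P x2) x0 x1 x2 x3 x4) => //; rewrite inE ?A1 ?A2 ?A3 -?E12 -?E23 ?E12 eqxx.
Qed.

(* [sd], [ld], [rd] are the dangling tree edge and the left and right dangling
   cycle edges, oriented towards the inside. *)
Record pole := Pole { body : {set V}; sd : V * V; ld : V * V; rd : V * V }.

Lemma dartP P d : d \in [:: sd P; ld P; rd P] ->
  [\/ d = sd P, d = ld P | d = rd P].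
Proof.
by rewrite !inE => /or3P[] /eqP; [apply: Or31 | apply: Or32 | apply: Or33].
Qed.

(** The flag [b] marks a one-vertex piece. There the outer ends are distinct, otherwise the inner
    ends are; with [wf_out] this determines which edges at an inner end lead outside. *)
Record wf (b : bool) (P : pole) : Prop := Wf {
  wf_dart : forall d, d \in [:: sd P; ld P; rd P] ->
     [/\ e d.1 d.2, d.1 \notin body P & d.2 \in body P];
  wf_out : forall u v, u \in body P -> v \notin body P -> e v u ->
     (v, u) \in [:: sd P; ld P; rd P];
  wf_leaf : b -> body P = [set (sd P).2] /\ uniq [:: (sd P).1; (ld P).1; (rd P).1];
  wf_nleaf : ~~ b -> uniq [:: (sd P).2; (ld P).2; (rd P).2] }.

Definition views_ok (A : {set V}) (P : pole) (u : state) (c : V -> V -> nat) :=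
  [/\ view_ok A c (sd P) (stem u), view_ok A c (ld P) (left u)
    & view_ok A c (rd P) (right u)].

Definition realizes (P : pole) (u : state) (c : V -> V -> nat) : Prop :=
  [/\ proper_on (body P) c, star_on (body P) c & views_ok (body P) P u c].

Lemma realizes_ext P u c c' :
  (forall d, d \in [:: sd P; ld P; rd P] -> e d.1 d.2 /\ d.2 \in body P) ->
  (forall v w, e v w -> (v \in body P) || (w \in body P) -> c' v w = c v w) ->
  realizes P u c -> realizes P u c'.
Proof.
move=> Hd E [Hp Hs [H1 H2 H3]].
have ext d f : d \in [:: sd P; ld P; rd P] ->
    view_ok (body P) c d f -> view_ok (body P) c' d f.
  case/Hd=> ed Ad [F1 F2 F3]; split.
  - by rewrite E ?Ad ?orbT.
  - by move=> z ez nz; rewrite E ?Ad //; apply: F2.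
  move=> z s zA ez nz es ns; rewrite E ?zA // => h.
  by rewrite E ?Ad //; apply: (F3 z s).
split.
- move=> u0 v w Av e1 e2 n; rewrite !E ?Av ?orbT //; exact: Hp.
- move=> x0 x1 x2 x3 x4 A1 A2 A3 e0 e1 e2 e3 n0 n1 n2.
  by rewrite !E ?A1 ?A2 ?A3 ?orbT //; apply: Hs.
by split; apply: ext; rewrite // !inE eqxx ?orbT.
Qed.

Lemma realizes_vertex P c p a b : coloring c -> wf true P ->
  c (sd P).1 (sd P).2 = p -> c (ld P).1 (ld P).2 = a ->
  c (rd P).1 (rd P).2 = b -> uniq [:: p; a; b] ->
  realizes P (vertex_state p a b) c.
Proof.
case=> csym _ W Hp Ha Hb U.
have [Eb Ux] := wf_leaf W isT.
set y := (sd P).2 in Eb.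
have [Dx _ _] : [/\ e (sd P).1 (sd P).2, (sd P).1 \notin body P & (sd P).2 \in body P]
  by apply: (wf_dart W); rewrite !inE eqxx.
have [Dl _ yl] : [/\ e (ld P).1 (ld P).2, (ld P).1 \notin body P & (ld P).2 \in body P]
  by apply: (wf_dart W); rewrite !inE eqxx ?orbT.
have [Dr _ yr] : [/\ e (rd P).1 (rd P).2, (rd P).1 \notin body P & (rd P).2 \in body P]
  by apply: (wf_dart W); rewrite !inE eqxx ?orbT.
move: yl yr; rewrite Eb !inE => /eqP yl /eqP yr.
have N z : e y z -> z \in [:: (sd P).1; (ld P).1; (rd P).1].
  move=> ez; have zy : z \notin body P.
    by rewrite Eb inE; apply/eqP => h; rewrite h e_irr in ez.
  have := @wf_out _ _ W y z; rewrite Eb inE eqxx => /(_ isT); rewrite -Eb => /(_ zy).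
  rewrite e_sym => /(_ ez); rewrite !inE /eq_op /= yl yr eqxx !andbT.
  by [].
rewrite yl in Ha; rewrite yr in Hb; rewrite -/y in Hp.
have C z : e y z -> c y z = if z == (sd P).1 then p else if z == (ld P).1 then a else b.
  move/N; rewrite !inE; case: eqP => [-> _|_]; first by rewrite csym.
  by case: eqP => [-> _|_ /= /eqP ->]; rewrite csym.
move: U Ux; rewrite /= !inE !negb_or !andbT => /andP[/andP[pa pb] ab] /andP[/andP[xl xr] lr].
split.
- move=> u v w; rewrite Eb inE => /eqP -> eu ew nuw; rewrite csym.
  rewrite e_sym in eu; rewrite !C //; move: (N _ eu) (N _ ew) nuw.
  rewrite !inE => /or3P[] /eqP -> /or3P[] /eqP ->; rewrite ?eqxx // => _;
   by rewrite ?(negPf xl) ?(negPf xr) ?(negPf lr) ?[_ == (sd P).1]eq_sym ?[(rd P).1 == _]eq_sym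
      ?(negPf xl) ?(negPf xr) ?(negPf lr) // eq_sym.
- move=> x0 x1 x2 x3 x4; rewrite Eb !inE => /eqP -> /eqP ->.
  by rewrite e_irr.
split; (split=> /=; first by rewrite ?yl ?yr); rewrite ?yl ?yr -/y.
- move=> z ez nz; move: (N _ ez); rewrite !inE C // (negPf nz).
  by do ?case: ifP => _; rewrite eqxx ?orbT.
- by move=> z s; rewrite Eb inE => /eqP ->; rewrite e_irr.
- move=> z ez nz; move: (N _ ez); rewrite !inE C // (negPf nz).
  by do ?case: ifP => _; rewrite eqxx ?orbT.
- by move=> z s; rewrite Eb inE => /eqP ->; rewrite e_irr.
- move=> z ez nz; move: (N _ ez); rewrite !inE (negPf nz) orbF C //.
  by do ?case: ifP => _ //=; rewrite eqxx ?orbT.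
- by move=> z s; rewrite Eb inE => /eqP ->; rewrite e_irr.
Qed.

(** An outer end outside [A] imposes nothing, so the empty list bounds it. *)
Definition outer_ok (A : {set V}) c (d : V * V) (X : seq nat) : Prop :=
  d.1 \in A -> forall s, e d.1 s -> s != d.2 -> c d.1 s \in X.

Lemma add_flags_ok (A B : {set V}) c d f (F : seq (nat * seq nat)) :
  view_ok B c d f ->
  (forall z, z \in A -> e d.2 z -> z != d.1 ->
     exists2 kX, kX \in F & c d.2 z = kX.1 /\
       (forall s, e z s -> s != d.2 -> c z s \in kX.2)) ->
  view_ok A c d (add_flags f F).
Proof.
case=> H1 H2 _ H; split=> // z s zA ez nz es ns E /=.
have [kX m [-> hX]] := H z zA ez nz.
rewrite mem_cat; apply/orP; right; apply/mapP; exists kX => //.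
by rewrite mem_filter m andbT -E; apply: hX.
Qed.

(** In a larger piece the inner ends are distinct, so every further neighbour of an inner end is in
    the body and the views do not change. In a one-vertex piece all neighbours are outer ends, and
    the new returns are those computed from [Xp], [Xa], [Xb]. *)
Lemma extend_views b P (A : {set V}) u c Xp Xa Xb :
  coloring c -> wf b P -> views_ok (body P) P u c ->
  outer_ok A c (sd P) Xp -> outer_ok A c (ld P) Xa -> outer_ok A c (rd P) Xb ->
  views_ok A P (extend b u Xp Xa Xb) c.
Proof.
case=> csym _ W [Hp Ha Hb] Op Oa Ob.
have [_ _ sB] := wf_dart W (mem_head _ _ : sd P \in [:: sd P; ld P; rd P]).
have [_ _ lB] : [/\ e (ld P).1 (ld P).2, (ld P).1 \notin body P & (ld P).2 \in body P]
  by apply: (wf_dart W); rewrite !inE eqxx ?orbT.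
have [_ _ rB] : [/\ e (rd P).1 (rd P).2, (rd P).1 \notin body P & (rd P).2 \in body P]
  by apply: (wf_dart W); rewrite !inE eqxx ?orbT.
case: b W => W; rewrite /extend; last first.
  have := wf_nleaf W isT.
  rewrite /= !inE negb_or andbT => /andP[/andP[nsl nsr] nlr].
  have inner d f : d \in [:: sd P; ld P; rd P] ->
      (forall d', d' \in [:: sd P; ld P; rd P] -> d'.2 = d.2 -> d' = d) ->
      view_ok (body P) c d f -> view_ok A c d f.
    move=> dP ud [H1 H2 H3]; split=> // z s _ ez nz; apply: H3 => //.
    apply/negPn/negP => zB; have [_ _ dB] := wf_dart W dP.
    have := wf_out W dB zB; rewrite e_sym ez => /(_ isT) /ud /= /(_ erefl) E.
    by rewrite -E eqxx in nz.
  split; apply: inner => //; rewrite ?inE ?eqxx ?orbT // => d;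
    rewrite !inE => /or3P[] /eqP -> // /eqP; rewrite ?(negPf nsl) ?(negPf nsr) ?(negPf nlr) //.
  - by rewrite eq_sym (negPf nsl).
  - by rewrite eq_sym (negPf nsr).
  - by rewrite eq_sym (negPf nlr).
have [EB _] := wf_leaf W isT.
set y := (sd P).2 in EB sB.
move: lB rB; rewrite EB !inE => /eqP yl /eqP yr.
have N z : e y z -> [\/ z = (sd P).1, z = (ld P).1 | z = (rd P).1].
  move=> ez; have zy : z \notin body P.
    by rewrite EB inE; apply/eqP => h; rewrite h e_irr in ez.
  have := wf_out W sB zy; rewrite e_sym => /(_ ez).
  rewrite !inE => /or3P[] /eqP <- /=; [exact: Or31 | exact: Or32 | exact: Or33].
have Cp : c y (sd P).1 = vcol (stem u) by case: Hp => <- _ _; rewrite csym.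
have Ca : c y (ld P).1 = vcol (left u) by case: Ha => <- _ _; rewrite csym yl.
have Cb : c y (rd P).1 = vcol (right u) by case: Hb => <- _ _; rewrite csym yr.
rewrite /outer_ok yl in Oa; rewrite /outer_ok yr in Ob.
have dp zs : (sd P).1 \in A -> e (sd P).1 zs -> zs != y -> c (sd P).1 zs \in Xp.
  by move=> h; apply: Op.
split; [apply: add_flags_ok Hp _ | apply: add_flags_ok Ha _ | apply: add_flags_ok Hb _];
  move=> z zA; rewrite ?yl ?yr -/y => ez nz; case: (N _ ez) => E; subst z;
  rewrite ?eqxx // in nz *.
- by exists (vcol (left u), Xa); rewrite ?inE ?eqxx ?orbT //; split=> // s; apply: Oa.
- by exists (vcol (right u), Xb); rewrite ?inE ?eqxx ?orbT //; split=> // s; apply: Ob.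
- by exists (vcol (stem u), Xp); rewrite ?inE ?eqxx ?orbT //; split=> // s; apply: dp.
- by exists (vcol (right u), Xb); rewrite ?inE ?eqxx ?orbT //; split=> // s; apply: Ob.
- by exists (vcol (stem u), Xp); rewrite ?inE ?eqxx ?orbT //; split=> // s; apply: dp.
- by exists (vcol (left u), Xa); rewrite ?inE ?eqxx ?orbT //; split=> // s; apply: Oa.
Qed.

Lemma nth_perm_inj s : s \in permutations (iota 0 6) ->
  {in [pred i | i < 6] &, injective (nth 0 s)} /\
  (forall i, i < 6 -> nth 0 s i < 6).
Proof.
rewrite mem_permutations => ps.
have sz : size s = 6 by rewrite (perm_size ps) size_iota.
split=> [i j|i] /=; rewrite ?inE.
  move=> hi hj /eqP; rewrite nth_uniq ?sz // ?(perm_uniq ps) ?iota_uniq //.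
  by move/eqP.
move=> hi; have : nth 0 s i \in s by rewrite mem_nth ?sz.
by rewrite (perm_mem ps) mem_iota.
Qed.

Lemma recolor_realizes P u c s : s \in permutations (iota 0 6) ->
  coloring c -> realizes P u c ->
  let c' v w := nth 0 s (c v w) in
  coloring c' /\ realizes P (recolor s u) c'.
Proof.
case/nth_perm_inj => inj lt6 [csym c6] [Hp Hs [H1 H2 H3]] c'.
have injc v w v' w' : c' v w = c' v' w' -> c v w = c v' w'.
  by apply: inj; rewrite inE c6.
have vw d f : view_ok (body P) c d f -> view_ok (body P) c' d (recolor_view s f).
  case=> F1 F2 F3; split=> [|z ez nz|z w zA ez nz ew nw] /=; first by rewrite /c' F1.
    by apply: map_f; apply: F2.
  by rewrite -F1 => /injc h; apply/map_f/(F3 z w) => //; rewrite -F1.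
split; first by split=> v w; rewrite /c' ?lt6 // csym.
split.
- move=> v0 v w A1 e1 e2 n; apply/eqP => /injc E.
  by have := Hp _ _ _ A1 e1 e2 n; rewrite E eqxx.
- move=> x0 x1 x2 x3 x4 A1 A2 A3 e0 e1 e2 e3 n0 n1 n2 /injc E1 /injc.
  exact: (Hs x0 x1 x2 x3 x4).
by split; apply: vw.
Qed.

Definition colorable (P : pole) (u : state) : Prop :=
  exists2 c, coloring c & realizes P u c.

Lemma colorable_all P n : (forall u, u \in base_states n -> colorable P u) ->
  forall u, u \in all_states n -> colorable P u.
Proof.
move=> H u /allpairsP[[s u0] /= [ms mu ->]].
have [c hc hr] := H _ mu; have [] := recolor_realizes ms hc hr.
by exists (fun v w => nth 0 s (c v w)).
Qed.

Lemma colorable_leaf P : wf true P ->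
  forall u, u \in base_states 1 -> colorable P u.
Proof.
move=> W u; rewrite inE => /eqP ->.
have [EB U] := wf_leaf W isT.
set y := (sd P).2 in EB.
have [_ _ lB] : [/\ e (ld P).1 (ld P).2, (ld P).1 \notin body P & (ld P).2 \in body P]
  by apply: (wf_dart W); rewrite !inE eqxx ?orbT.
have [_ _ rB] : [/\ e (rd P).1 (rd P).2, (rd P).1 \notin body P & (rd P).2 \in body P]
  by apply: (wf_dart W); rewrite !inE eqxx ?orbT.
have oy d : d \in [:: sd P; ld P; rd P] -> d.1 == y = false.
  by case/(wf_dart W) => _; rewrite EB !inE => /negPf.
move: lB rB; rewrite EB !inE => /eqP yl /eqP yr.
pose f z := if z == (sd P).1 then 0 else if z == (ld P).1 then 1 else 2.
pose c v w := if v == y then f w else if w == y then f v else 0.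
have f6 z : f z < 6 by rewrite /f; do !case: ifP.
have hc : coloring c.
  split=> v w; rewrite /c; last by do !case: ifP.
  by case: (v =P y) => [Ev|_]; case: (w =P y) => [Ew|_]; rewrite ?Ev ?Ew.
exists c => //; move: U; rewrite /= !inE !negb_or andbT => /andP[/andP[xl xr] lr].
apply: realizes_vertex => //; rewrite /c ?yl ?yr -/y eqxx oy ?inE ?eqxx ?orbT // /f.
- by rewrite eqxx.
- by rewrite eq_sym (negPf xl) eqxx.
- by rewrite eq_sym (negPf xr) eq_sym (negPf lr).
Qed.

Lemma outer_of_view (A B : {set V}) c d f :
  view_ok B c (swap d) f -> outer_ok A c d (vadj f).
Proof. by case=> _ H _ _; apply: H. Qed.

Lemma outer_out (A : {set V}) c d X : d.1 \notin A -> outer_ok A c d X.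
Proof. by move=> /negPf h; rewrite /outer_ok h. Qed.

Lemma star_on_sub (A B : {set V}) c :
  {subset A <= B} -> star_on B c -> star_on A c.
Proof.
move=> AB H x0 x1 x2 x3 x4 A1 A2 A3; exact: (H x0 x1 x2 x3 x4 (AB _ A1) (AB _ A2) (AB _ A3)).
Qed.

Lemma extend_vcol b u Xp Xa Xb :
  [/\ vcol (stem (extend b u Xp Xa Xb)) = vcol (stem u),
      vcol (left (extend b u Xp Xa Xb)) = vcol (left u)
    & vcol (right (extend b u Xp Xa Xb)) = vcol (right u)].
Proof. by case: b. Qed.

(** * Joining two pieces at a new vertex *)

Section Node.

Variables (b1 b2 : bool) (P1 P2 : pole) (x y : V).
Hypotheses (W1 : wf b1 P1) (W2 : wf b2 P2).
Hypotheses (s1 : (sd P1).1 = y) (s2 : (sd P2).1 = y).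
Hypothesis joint : rd P1 = swap (ld P2).
Hypothesis dis : forall v, v \in body P1 -> v \notin body P2.

Let A := y |: (body P1 :|: body P2).

Definition node_pole := Pole A (x, y) (ld P1) (rd P2).

Hypotheses (xA : x \notin A) (lA : (ld P1).1 \notin A) (rA : (rd P2).1 \notin A).
Hypothesis Ny : forall z, e y z = (z \in [:: x; (sd P1).2; (sd P2).2]).
Hypothesis Uy : uniq [:: x; (sd P1).2; (sd P2).2].

Let in_sd (P : pole) : sd P \in [:: sd P; ld P; rd P].
Proof. by rewrite inE eqxx. Qed.
Let in_ld (P : pole) : ld P \in [:: sd P; ld P; rd P].
Proof. by rewrite !inE eqxx orbT. Qed.
Let in_rd (P : pole) : rd P \in [:: sd P; ld P; rd P].
Proof. by rewrite !inE eqxx !orbT. Qed.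

Let y1 := (sd P1).2.
Let y2 := (sd P2).2.
Let y1A : y1 \in body P1. Proof. by case: (wf_dart W1 (in_sd _)). Qed.
Let y2A : y2 \in body P2. Proof. by case: (wf_dart W2 (in_sd _)). Qed.
Let yA1 : y \notin body P1. Proof. by rewrite -s1; case: (wf_dart W1 (in_sd _)). Qed.
Let yA2 : y \notin body P2. Proof. by rewrite -s2; case: (wf_dart W2 (in_sd _)). Qed.
Let dis' v : v \in body P2 -> v \notin body P1.
Proof. by move=> h; apply/negP => /dis; rewrite h. Qed.
Let sub1 v : v \in body P1 -> v \in A.
Proof. by rewrite !inE => ->; rewrite orbT. Qed.
Let sub2 v : v \in body P2 -> v \in A.
Proof. by rewrite !inE => ->; rewrite !orbT. Qed.
Let subT v : v \in A -> [\/ v = y, v \in body P1 | v \in body P2].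
Proof. by rewrite !inE => /or3P[/eqP|?|?]; [apply: Or31 | apply: Or32 | apply: Or33]. Qed.

(** The other dangling edges of [P2] start at [y] or outside [A]. *)
Let cross12 v w : v \in body P1 -> w \in body P2 -> e v w -> ld P2 = (v, w).
Proof.
move=> v1 w2 evw; have := wf_out W2 w2 (dis v1) evw; rewrite !inE => /or3P[] /eqP E //.
  by move: yA1; rewrite -s2 -E /= v1.
by move: rA; rewrite -E /= sub1.
Qed.

Let crossy1 w : w \in body P1 -> e y w -> w = y1.
Proof.
move=> w1; rewrite Ny !inE => /or3P[] /eqP // E; subst w; last by move: (dis w1); rewrite y2A.
by move: xA; rewrite sub1.
Qed.

Let crossy2 w : w \in body P2 -> e y w -> w = y2.
Proof.
move=> w1; rewrite Ny !inE => /or3P[] /eqP // E; subst w; last by move: (dis' w1); rewrite y1A.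
by move: xA; rewrite sub2.
Qed.

Lemma wf_node : wf false node_pole.
Proof.
have [el lB lB1] := wf_dart W1 (in_ld _).
have [er rB rB2] := wf_dart W2 (in_rd _).
split=> //.
- move=> d /dartP[] -> /=.
  + by split; rewrite ?setU11 // e_sym Ny inE eqxx.
  + by split=> //; apply: sub1.
  + by split=> //; apply: sub2.
- move=> u v uA vA evu; move: vA; rewrite !inE !negb_or => /and3P[vy v1 v2].
  case: (subT uA) => [E|u1|u2].
  + subst u; move: evu; rewrite e_sym Ny !inE => /or3P[] /eqP E; subst v.
    * by rewrite eqxx.
    * by rewrite y1A in v1.
    * by rewrite y2A in v2.
  + have := wf_out W1 u1 v1 evu; rewrite !inE => /or3P[] /eqP E.
    * by move: vy; rewrite -s1 -E eqxx.
    * by rewrite E eqxx orbT.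
    * have [_ _ h] := wf_dart W2 (in_ld _).
      by move: v2; move: E; rewrite joint => -[-> _]; rewrite h.
  + have := wf_out W2 u2 v2 evu; rewrite !inE => /or3P[] /eqP E.
    * by move: vy; rewrite -s2 -E eqxx.
    * have [_ _ h] := wf_dart W1 (in_rd _); move: h; rewrite joint -E /=.
      by rewrite (negPf v1).
    * by rewrite E eqxx !orbT.
move=> _; rewrite /= !inE !negb_or !andbT -andbA; apply/and3P; split.
- by apply/eqP => E; move: yA1; rewrite E lB1.
- by apply/eqP => E; move: yA2; rewrite E rB2.
- by apply/eqP => E; move: (dis lB1); rewrite E rB2.
Qed.

(** The new vertex is a one-vertex piece itself, whose left and right dangling edges are the stems
    of [P1] and [P2]; the three parts can then be treated alike. *)
Let Py := Pole [set y] (x, y) (y1, y) (y2, y).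

Let wfy : wf true Py.
Proof.
split=> //=.
- have xy : x != y by apply/eqP => E; move: xA; rewrite E !inE eqxx.
  move=> d; rewrite !inE => /or3P[] /eqP -> /=; split; rewrite ?inE //;
    try by rewrite e_sym Ny !inE eqxx ?orbT.
  + by apply: contraNneq yA1 => <-.
  + by apply: contraNneq yA2 => <-.
- move=> u v; rewrite !inE => /eqP -> _; rewrite e_sym Ny !inE.
  by case/or3P => /eqP ->; rewrite eqxx ?orbT.
Qed.

(** The two colourings agree on the shared cycle edge since [compat] compares colours. It also
    excludes returns across each of the three internal edges, so [star_on_parts] applies. *)
Lemma colorable_node u1 u2 u : node_check b1 b2 u1 u2 u ->
  colorable P1 u1 -> colorable P2 u2 -> colorable node_pole u.
Proof.
rewrite /node_check; set p := vcol (stem u); set p1 := vcol (stem u1).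
set p2 := vcol (stem u2); set ey := extend true _ _ _ _.
set e1 := extend b1 _ _ _ _; set e2 := extend b2 _ _ _ _.
case/and5P=> p6 Up C12 Cy1 /and4P[Cy2 Ly L1 L2] [c1 [sym1 lt1] R1] [c2 [sym2 lt2] R2].
(* Edges meeting [P1] or [P2], the stems at [y] among them, keep their colours; of the edges meeting
   [A] only [xy] is left, with colour [p]. *)
pose c v w := if (v \in body P1) || (w \in body P1) then c1 v w else
  if (v \in body P2) || (w \in body P2) then c2 v w else p.
have hc : coloring c.
  by split=> v w; rewrite /c; [rewrite sym1 sym2 ![(v \in _) || _]orbC | do !case: ifP].
have ed P b (W : wf b P) d : d \in [:: sd P; ld P; rd P] -> e d.1 d.2 /\ d.2 \in body P.
  by case/(wf_dart W).
have E12 : vcol (right u1) = vcol (left u2).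
  case/and3P: C12 => /eqP + _ _; rewrite /e1 /e2.
  have [_ _ ->] := extend_vcol b1 u1 [:: p; p2] [::] (vadj (left u2)).
  by have [_ -> _] := extend_vcol b2 u2 [:: p; p1] (vadj (right u1)) [::].
have R1c : realizes P1 u1 c.
  apply: realizes_ext R1; first exact: ed W1.
  by move=> v w _ h; rewrite /c h.
have R2c : realizes P2 u2 c.
  case: (R1) (R2) => _ _ [_ _ [Er _ _]] [_ _ [_ [El _ _] _]].
  have agree v w : v \in body P1 -> w \in body P2 -> e v w -> c1 v w = c2 v w.
    move=> v1 w2 evw; have E := cross12 v1 w2 evw.
    by move: Er El; rewrite joint E /= sym1 => -> ->.
  apply: realizes_ext R2; first exact: ed W2.
  move=> v w evw; rewrite /c; case: ifP => [|_ ->] //.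
  case/orP => h1 /orP[] h2; try by move: (dis h1); rewrite h2.
    exact: agree.
  by rewrite sym1 sym2; apply: agree => //; rewrite e_sym.
have [_ _ [V1s V1l V1r]] := R1c; have [_ _ [V2s V2l V2r]] := R2c.
have Ry : realizes Py (vertex_state p p1 p2) c.
  apply: realizes_vertex => //=; rewrite ?(proj1 hc _ y).
  - move: xA; rewrite !inE !negb_or /c => /and3P[_ /negPf -> /negPf ->].
    by rewrite (negPf yA1) (negPf yA2).
  - by case: V1s; rewrite s1.
  - by case: V2s; rewrite s2.
have [_ _ [Vyp Vy1 Vy2]] := Ry.
have sp1 : sd P1 = (y, y1) by rewrite -s1 /y1 -surjective_pairing.
have sp2 : sd P2 = (y, y2) by rewrite -s2 /y2 -surjective_pairing.
have jl : swap (ld P2) = rd P1 by rewrite joint.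
have jr : swap (rd P1) = ld P2 by rewrite joint; case: (ld P2).
(* Views are now taken with respect to all of [A], so that returns through the other parts count as
   well. *)
have [X1s X1l X1r] : views_ok A P1 e1 c.
  apply: extend_views => //.
  - by rewrite sp1; exact: (@outer_of_view _ _ _ (y, y1) _ Vy1).
  - exact: outer_out.
  - by apply: outer_of_view; rewrite jr; apply: V2l.
have [X2s X2l X2r] : views_ok A P2 e2 c.
  apply: extend_views => //.
  - by rewrite sp2; exact: (@outer_of_view _ _ _ (y, y2) _ Vy2).
  - by apply: outer_of_view; rewrite jl; apply: V1r.
  - exact: outer_out.
have [Xyp Xy1 Xy2] : views_ok A Py ey c.
  apply: extend_views => //.
  - exact: outer_out.
  - by apply: outer_of_view; rewrite /swap /= -sp1; apply: V1s.
  - by apply: outer_of_view; rewrite /swap /= -sp2; apply: V2s.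
have [N1 N1'] : no_return A c (y1, y) /\ no_return A c (y, y1).
  by apply: (compat_no_return hc Cy1 Xy1); rewrite /swap /= -sp1.
have [N2 N2'] : no_return A c (y2, y) /\ no_return A c (y, y2).
  by apply: (compat_no_return hc Cy2 Xy2); rewrite /swap /= -sp2.
have [N3 N3'] : no_return A c (rd P1) /\ no_return A c (ld P2).
  by have := compat_no_return hc C12 X1r; rewrite jr; apply.
have [pr1 st1 _] := R1c; have [pr2 st2 _] := R2c; have [pry sty _] := Ry.
exists c => //; split.
- move=> v0 v w /subT[->|h|h]; [apply: pry | exact: pr1 | exact: pr2].
  by rewrite inE.
- apply: (star_on_parts (P := fun v => if v \in body P1 then 1 else
     if v \in body P2 then 2 else 0)) => //.
    case=> [|[|i]].
    + apply: star_on_sub sty => v; rewrite inE => /andP[/subT[->|->|h]] //.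
      by rewrite inE.
      by rewrite h; case: ifP.
    + apply: star_on_sub st1 => v; rewrite inE => /andP[_].
      by case: ifP => // _; case: ifP.
    + apply: star_on_sub st2 => v; rewrite inE => /andP[_].
      by case: ifP => // _; case: ifP.
  move=> v w vA wA evw.
  case/subT: vA => [Ev|v1|v2]; case/subT: wA => [Ew|w1|w2]; subst => //.
  + by rewrite e_irr in evw.
  + by rewrite (crossy1 w1 evw).
  + by rewrite (crossy2 w2 evw).
  + by rewrite e_sym in evw; rewrite (crossy1 v1 evw).
  + by rewrite v1 w1.
  + by rewrite -(cross12 v1 w2 evw).
  + by rewrite e_sym in evw; rewrite (crossy2 v2 evw).
  + by rewrite e_sym in evw; move: N3; rewrite joint (cross12 w1 v2 evw).
  + by rewrite (negPf (dis' v2)) (negPf (dis' w2)) v2 w2.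
by split; [apply: view_le Ly Xyp | apply: view_le L1 X1l | apply: view_le L2 X2r].
Qed.

End Node.

(** Complementary pieces share exactly their three dangling edges; the colourings are merged as in
    [colorable_node], now without a new vertex. *)
Lemma colorable_close b1 b2 P1 P2 u1 u2 :
  wf b1 P1 -> wf b2 P2 ->
  (forall v, (v \in body P2) = (v \notin body P1)) ->
  sd P1 = swap (sd P2) -> ld P1 = swap (rd P2) -> rd P1 = swap (ld P2) ->
  close_check b1 b2 u1 u2 -> colorable P1 u1 -> colorable P2 u2 ->
  exists c, [/\ coloring c, proper_on [set: V] c & star_on [set: V] c].
Proof.
move=> W1 W2 com js jl jr.
rewrite /close_check; set e1 := extend b1 _ _ _ _; set e2 := extend b2 _ _ _ _.
case/and3P=> Cs Cl Cr [c1 [sym1 lt1] R1] [c2 [sym2 lt2] R2].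
have [x1s x1l x1r] := extend_vcol b1 u1 (vadj (stem u2)) (vadj (right u2)) (vadj (left u2)).
have [x2s x2l x2r] := extend_vcol b2 u2 (vadj (stem u1)) (vadj (right u1)) (vadj (left u1)).
have Es : vcol (stem u1) = vcol (stem u2).
  by case/and3P: Cs => /eqP + _ _; rewrite x1s x2s.
have El : vcol (left u1) = vcol (right u2).
  by case/and3P: Cl => /eqP + _ _; rewrite x1l x2r.
have Er : vcol (right u1) = vcol (left u2).
  by case/and3P: Cr => /eqP + _ _; rewrite x1r x2l.
pose c v w := if (v \in body P1) || (w \in body P1) then c1 v w else c2 v w.
have hc : coloring c.
  by split=> v w; rewrite /c; [rewrite sym1 sym2 [(v \in _) || _]orbC | case: ifP].
have ed P b (W : wf b P) d : d \in [:: sd P; ld P; rd P] -> e d.1 d.2 /\ d.2 \in body P.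
  by case/(wf_dart W).
have R1c : realizes P1 u1 c.
  apply: realizes_ext R1; first exact: ed W1.
  by move=> v w _ h; rewrite /c h.
have cross v w : v \in body P1 -> w \in body P2 -> e v w ->
    (v, w) \in [:: sd P2; ld P2; rd P2].
  by move=> v1 w2; apply: (wf_out W2) => //; rewrite com v1.
have R2c : realizes P2 u2 c.
  case: (R1) (R2) => _ _ [[F1 _ _] [F2 _ _] [F3 _ _]] [_ _ [[G1 _ _] [G2 _ _] [G3 _ _]]].
  have agree v w : v \in body P1 -> w \in body P2 -> e v w -> c1 v w = c2 v w.
    move=> v1 w2 evw; move: (cross _ _ v1 w2 evw); rewrite !inE.
    case/or3P => /eqP E; [move: F1 G1 | move: F3 G2 | move: F2 G3];
      by rewrite ?js ?jl ?jr -E /= sym1 => -> ->.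
  apply: realizes_ext R2; first exact: ed W2.
  move=> v w evw; rewrite /c; case: ifP => // /orP[] h1 /orP[] h2;
    try by move: h2; rewrite com h1.
    exact: agree.
  by rewrite sym1 sym2; apply: agree => //; rewrite e_sym.
have [pr1 st1 [V1s V1l V1r]] := R1c; have [pr2 st2 [V2s V2l V2r]] := R2c.
have sw d : swap (swap d) = d by case: d.
have [X1s X1l X1r] : views_ok setT P1 e1 c.
  apply: extend_views => //; apply: outer_of_view; rewrite ?js ?jl ?jr sw;
    [exact: V2s | exact: V2r | exact: V2l].
have [X2s X2l X2r] : views_ok setT P2 e2 c.
  apply: extend_views => //; apply: outer_of_view; rewrite -?js -?jl -?jr;
    [exact: V1s | exact: V1r | exact: V1l].
have [N1 N1'] : no_return setT c (sd P1) /\ no_return setT c (sd P2).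
  by have := compat_no_return hc Cs X1s; rewrite js sw; apply.
have [N2 N2'] : no_return setT c (ld P1) /\ no_return setT c (rd P2).
  by have := compat_no_return hc Cl X1l; rewrite jl sw; apply.
have [N3 N3'] : no_return setT c (rd P1) /\ no_return setT c (ld P2).
  by have := compat_no_return hc Cr X1r; rewrite jr sw; apply.
have NR v w : v \in body P1 -> w \in body P2 -> e v w ->
    no_return setT c (v, w) /\ no_return setT c (w, v).
  move=> v1 w2 evw; move: (cross _ _ v1 w2 evw); rewrite !inE.
  rewrite -[(w, v)]/(swap (v, w)).
  by case/or3P => /eqP ->; split; rewrite // -?js -?jl -?jr.
exists c; split=> //.
- move=> u v w _; case v1: (v \in body P1); first exact: pr1.
  by apply: pr2; rewrite com v1.
apply: (star_on_parts (P := fun v => v \in body P1 : nat)) => //.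
  case=> [|i].
    by apply: star_on_sub st2 => v; rewrite inE com => /andP[_]; case: (v \in _).
  by apply: star_on_sub st1 => v; rewrite inE => /andP[_]; case: (v \in _).
move=> v w _ _ evw; case v1: (v \in body P1); case w1: (w \in body P1) => // _.
  by have [] := NR v w v1 _ evw; rewrite // com w1.
by rewrite e_sym in evw; have [] := NR w v w1 _ evw; rewrite // com v1.
Qed.

End Poles.

(** * Branches of a plane tree *)

Section Walks.

Variables (V : finType) (t : rel V).
Hypotheses (t_sym : symmetric t) (t_irr : irreflexive t).
Hypothesis t_acyclic : forall c : seq V, 2 < size c -> ~ ucycle t c.

Definition nonbacktracking (s : seq V) : Prop :=
  sorted t s /\
  forall s1 a b c s2, s = s1 ++ [:: a, b, c & s2] -> a != c.

Lemma nonbacktracking_cons x y s : t x y -> x != head y s ->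
  nonbacktracking (y :: s) -> nonbacktracking [:: x, y & s].
Proof.
move=> txy xs [srt nb]; split; first by rewrite /= txy.
case=> [|z s1] a b c s2 [] => [Ea _ Es|_ Es]; last exact: nb Es.
by rewrite -Ea; rewrite Es in xs.
Qed.

Lemma nonbacktracking_rev s : nonbacktracking s -> nonbacktracking (rev s).
Proof.
case=> srt nb; split.
  by rewrite rev_sorted (@eq_sorted _ _ t) // => a b; apply: t_sym.
move=> s1 a b c s2 E; rewrite eq_sym; apply: (nb (rev s2) c b a (rev s1)).
by rewrite -[s]revK E rev_cat !rev_cons -!cats1 -!catA.
Qed.

(** The part from the head to a repetition of it closes a cycle. Loops and immediate returns being
    excluded, it has at least three vertices, against acyclicity. *)
Lemma nonbacktracking_uniq s : nonbacktracking s -> uniq s.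
Proof.
elim: s => // x s IH [srt nb].
have us : uniq s.
  apply: IH; split; first by case: (s) srt => //= y s' /andP[].
  by move=> s1 a b c s2 E; apply: (nb (x :: s1) a b c s2); rewrite E.
rewrite /= us andbT; apply/negP => xs.
case/splitPr: xs srt nb us => s1 s2; rewrite /= cat_path /= => /and3P[p1 l1 _] nb.
rewrite cat_uniq /= negb_or => /and3P[u1 /andP[x1 _] _].
case: s1 p1 l1 nb u1 x1 => [|a [|b s1]] p1 l1 nb u1 x1.
- by rewrite t_irr in l1.
- by have := nb [::] x a x s2 erefl; rewrite eqxx.
apply: (@t_acyclic [:: x, a, b & s1]) => //.
apply/andP; split; last by move: u1 x1 => /= ->; rewrite andbT.
by rewrite [cycle _ _]/= rcons_path; move: p1 l1 => /= /and3P[-> -> ->].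
Qed.

End Walks.

Section Branches.

Variables (V : finType) (t : rel V) (rot : V -> {perm V}).
Hypothesis t_tree : is_tree t.
Hypothesis rotP : rotation_system t rot.
Hypothesis t_cubic : forall v, ~~ leaf t v -> degree t v = 3.

Let t_sym : symmetric t. Proof. by case: t_tree. Qed.
Let t_irr : irreflexive t. Proof. by case: t_tree. Qed.
Let nb_uniq s : nonbacktracking t s -> uniq s.
Proof. by case: t_tree => _ ti _ ta; apply: nonbacktracking_uniq. Qed.

Lemma rot_leaf x y : leaf t y -> t y x ->
  rot y x = x /\ forall z, t y z = (z == x).
Proof.
move=> /eqP ly tyx; have E := rotP tyx.
have c1 : #|porbit (rot y) x| = 1 by rewrite E.
split=> [|z]; first by have := iter_porbit (rot y) x; rewrite c1.
have -> : t y z = (z \in porbit (rot y) x) by rewrite E inE.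
by rewrite porbit_traject c1 inE.
Qed.

Lemma rot_node x y : ~~ leaf t y -> t y x ->
  let y1 := rot y x in let y2 := rot y y1 in
  [/\ rot y y2 = x, uniq [:: x; y1; y2]
    & forall z, t y z = (z \in [:: x; y1; y2])].
Proof.
move=> /t_cubic d3 tyx; have E := rotP tyx.
have c3 : #|porbit (rot y) x| = 3 by rewrite E.
split=> [||z]; first by have := iter_porbit (rot y) x; rewrite c3.
  by have := uniq_traject_porbit (rot y) x; rewrite c3.
have -> : t y z = (z \in porbit (rot y) x) by rewrite E inE.
by rewrite porbit_traject c3.
Qed.

(* [branch x y D]: [D] is the part of the boundary walk that follows the dart
   [(x, y)], up to and including its reverse [(y, x)]. *)
Inductive branch : V -> V -> seq (V * V) -> Prop :=
| Branch_leaf x y : leaf t y -> t y x -> branch x y [:: (y, x)]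
| Branch_node x y D1 D2 : ~~ leaf t y -> t y x ->
    branch y (rot y x) D1 -> branch y (rot y (rot y x)) D2 ->
    branch x y
      ((y, rot y x) :: D1 ++ (y, rot y (rot y x)) :: D2 ++ [:: (y, x)]).

Definition verts (D : seq (V * V)) : {set V} := [set v in map fst D].

Definition leaves (D : seq (V * V)) : seq V := [seq v <- map fst D | leaf t v].

Lemma verts_leaf x y : verts [:: (y, x)] = [set y].
Proof. by apply/setP => v; rewrite !inE. Qed.

Lemma verts_node x y y1 y2 D1 D2 :
  verts ((y, y1) :: D1 ++ (y, y2) :: D2 ++ [:: (y, x)]) =
  y |: (verts D1 :|: verts D2).
Proof.
apply/setP => v; rewrite !(map_cons, map_cat, mem_cat, inE) /=.
by case: (v == y); rewrite // ?orbF.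
Qed.

Lemma leaves_node x y y1 y2 D1 D2 : ~~ leaf t y ->
  leaves ((y, y1) :: D1 ++ (y, y2) :: D2 ++ [:: (y, x)]) =
  leaves D1 ++ leaves D2.
Proof.
move=> /negPf ly.
by rewrite /leaves /= !map_cat /= map_cat !(filter_cat, ly, cats0) /= filter_cat /= ly cats0.
Qed.

Lemma branch_adj x y D : branch x y D -> t y x.
Proof. by case. Qed.

Lemma branch_root x y D : branch x y D -> y \in verts D.
Proof. by case=> *; rewrite !inE eqxx. Qed.

(** Each descent into the tree prolongs a non-backtracking walk, which is simple and so has at most
    [#|V|] vertices; hence the recursion ends. *)
Lemma branch_exists x y : t y x -> exists D, branch x y D.
Proof.
move=> tyx.
have H n : forall s x y, nonbacktracking t [:: y, x & s] -> #|V| < n + size s ->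
    exists D, branch x y D.
  elim: n => [|n IH] s {tyx}x {}y nb lt.
    have /card_uniqP E := nb_uniq nb.
    by have := max_card (mem [:: y, x & s]); rewrite E leqNgt /= ltnS ltnW // ltnW.
  have tyx : t y x by case: nb => /= /andP[].
  case: (boolP (leaf t y)) => ly; first by exists [:: (y, x)]; apply: Branch_leaf.
  have [_ U N] := rot_node ly tyx.
  have next z : z \in [:: rot y x; rot y (rot y x)] -> exists D, branch y z D.
    move=> zN; apply: (IH (x :: s)); last by rewrite /= addnS.
    apply: nonbacktracking_cons => //=.
      by rewrite t_sym N inE zN orbT.
    by apply: contraTneq zN => ->; case/andP: U.
  have [|D1 b1] := next (rot y x); first by rewrite inE eqxx.
  have [|D2 b2] := next (rot y (rot y x)); first by rewrite !inE eqxx orbT.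
  by eexists; apply: Branch_node b1 b2.
apply: (H #|V|.+1 [::]); last by rewrite addn0.
by split=> [|[|a [|b [|c s1]]]] //=; rewrite tyx.
Qed.

(** Walks are listed from their newest vertex. Descending from [y] to [v] never turns back, so
    membership in a branch becomes a statement on simple paths. *)
Lemma branch_walk x y D v s : branch x y D -> v \in verts D ->
  nonbacktracking t [:: y, x & s] ->
  exists2 s', v \in rcons s' y & nonbacktracking t (s' ++ [:: y, x & s]).
Proof.
move=> b; elim: b s v => {x y D} [x y ly tyx|x y D1 D2 ly tyx b1 IH1 b2 IH2] s v.
  by rewrite verts_leaf inE => /eqP -> nb; exists [::] => //; rewrite inE.
rewrite verts_node in_setU1 in_setU => vD nb; have [_ U N] := rot_node ly tyx.
have next z : z \in [:: rot y x; rot y (rot y x)] ->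
    nonbacktracking t [:: z, y, x & s].
  move=> zN; apply: nonbacktracking_cons => //=; first by rewrite t_sym N inE zN orbT.
  by apply: contraTneq zN => ->; case/andP: U.
have fin z s' : v \in rcons s' z -> nonbacktracking t (s' ++ [:: z, y, x & s]) ->
    exists2 s', v \in rcons s' y & nonbacktracking t (s' ++ [:: y, x & s]).
  move=> h1 h2; exists (rcons s' z); last by rewrite cat_rcons.
  by rewrite mem_rcons inE h1 orbT.
case/or3P: vD => [/eqP ->|v1|v2]; first by exists [::]; rewrite ?inE.
  have [s' h1 h2] := IH1 (x :: s) v v1 (next _ (mem_head _ _)).
  exact: fin h1 h2.
have [s' h1 h2] := IH2 (x :: s) v v2 (next _ (mem_last _ [:: _])).
exact: fin h1 h2.
Qed.

Lemma nonbacktracking2 x y : t y x -> nonbacktracking t [:: y; x].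
Proof. by move=> tyx; split=> [|[|a [|b [|c s1]]]] //=; rewrite tyx. Qed.

Lemma branch_out x y D : branch x y D -> x \notin verts D.
Proof.
move=> b; apply/negP => /(branch_walk b)/(_ (nonbacktracking2 (branch_adj b))).
case=> s' xs' /nb_uniq; rewrite -cat_rcons cat_uniq => /and3P[_ /hasPn/(_ x) + _].
by rewrite inE eqxx => /(_ isT); rewrite xs'.
Qed.

(** From a common vertex [v] one could walk out of the first branch and, by the second hypothesis,
    on into the other one, meeting [v] again without ever turning back. *)
Lemma branch_disjoint x y D x' y' D' v : branch x y D -> branch x' y' D' ->
  (forall s, nonbacktracking t [:: x, y & s] ->
     exists s1, nonbacktracking t [:: y', x' & s1] /\ {subset y :: s <= x' :: s1}) ->
  v \in verts D -> v \notin verts D'.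
Proof.
move=> b b' H vD; apply/negP => vD'.
have [s vs /(nonbacktracking_rev t_sym)] := branch_walk b vD (nonbacktracking2 (branch_adj b)).
rewrite rev_cat => /H[s1 [nb1 sub]].
have vs1 : v \in x' :: s1 by apply: sub; move: vs; rewrite mem_rcons !inE mem_rev.
have [s' vs' /nb_uniq] := branch_walk b' vD' nb1.
rewrite -cat_rcons cat_uniq => /and3P[_ /hasPn/(_ v vs1)].
by rewrite vs'.
Qed.

Lemma branch_opposite x y D D' v : branch x y D -> branch y x D' ->
  v \in verts D -> v \notin verts D'.
Proof. by move=> b b'; apply: (branch_disjoint b b') => s nb; exists s; split. Qed.

Lemma branch_sibling x y z D D' v : branch x y D -> branch x z D' -> y != z ->
  v \in verts D -> v \notin verts D'.
Proof.
move=> b b' yz; apply: (branch_disjoint b b') => s nb; exists (y :: s).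
split; last by move=> w; rewrite [in X in _ -> X]inE => ->; rewrite orbT.
apply: nonbacktracking_cons nb; first exact: branch_adj b'.
by rewrite eq_sym.
Qed.

Lemma branch_closed x y D v w : branch x y D -> v \in verts D -> t v w ->
  w \in verts D \/ (v, w) = (y, x).
Proof.
move=> b; elim: b v w => {x y D} [x y ly tyx|x y D1 D2 ly tyx b1 IH1 b2 IH2] v w.
  have [_ N] := rot_leaf ly tyx.
  by rewrite verts_leaf inE => /eqP ->; rewrite N => /eqP ->; right.
rewrite verts_node in_setU1 in_setU => /or3P[/eqP ->|v1|v2] tvw.
- have [_ _ N] := rot_node ly tyx.
  move: tvw; rewrite N 3!in_cons orbF => /or3P[] /eqP ->; first by right.
    by left; rewrite in_setU1 in_setU (branch_root b1) orbT.
  by left; rewrite in_setU1 in_setU (branch_root b2) !orbT.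
- left; rewrite in_setU1 in_setU.
  by have [->|[_ ->]] := IH1 v w v1 tvw; rewrite ?eqxx ?orbT.
left; rewrite in_setU1 in_setU.
by have [->|[_ ->]] := IH2 v w v2 tvw; rewrite ?eqxx ?orbT.
Qed.

Lemma branch_path x y D : branch x y D ->
  fpath (face_step rot) (x, y) D /\ last (x, y) D = (y, x).
Proof.
elim=> {x y D} [x y ly tyx|x y D1 D2 ly tyx _ [p1 l1] _ [p2 l2]].
  by have [E _] := rot_leaf ly tyx; rewrite /= /face_step /= E eqxx.
have [E _ _] := rot_node ly tyx.
rewrite /= cat_path p1 l1 /= cat_path p2 l2 last_cat /= last_cat /=.
by rewrite /face_step /= E !eqxx.
Qed.

Lemma mem_verts D v w : (v, w) \in D -> v \in verts D.
Proof. by move=> h; rewrite inE; apply/mapP; exists (v, w). Qed.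

Lemma branch_uniq x y D : branch x y D -> uniq D.
Proof.
elim=> {x y D} [//|x y D1 D2 ly tyx b1 u1 b2 u2].
have [_ U _] := rot_node ly tyx.
move: U; rewrite /= !inE negb_or andbT => /andP[/andP[n1 n2] n12].
have y1 z : (y, z) \notin D1 by apply: contra (branch_out b1) => /mem_verts.
have y2 z : (y, z) \notin D2 by apply: contra (branch_out b2) => /mem_verts.
rewrite cats1 mem_cat inE mem_rcons inE !negb_or y1 y2 !cat_uniq /= rcons_uniq.
rewrite !mem_rcons !inE !negb_or y1 u1 y2 u2 !xpair_eqE eqxx /= !andbT n12.
rewrite ![_ == x]eq_sym n1 n2 y2 /= ?andbT; apply/hasPn => -[v w].
rewrite mem_rcons inE xpair_eqE => /orP[/andP[/eqP -> _]|]; first exact: y1.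
move/mem_verts => v2; apply: contraL v2 => /mem_verts.
exact: branch_sibling b1 b2 n12.
Qed.

Lemma mem_leaves D v : (v \in leaves D) = leaf t v && (v \in verts D).
Proof. by rewrite mem_filter /verts inE. Qed.

Lemma branch_leaves_uniq x y D : branch x y D -> uniq (leaves D).
Proof.
elim=> {x y D} [x y ly tyx|x y D1 D2 ly tyx b1 u1 b2 u2].
  by rewrite /leaves /= ly.
have [_ U _] := rot_node ly tyx; move: U.
rewrite leaves_node // cat_uniq u1 u2 andbT /= !inE => /and3P[_ n12 _].
apply/hasPn => v; rewrite !mem_leaves => /andP[-> v2] /=.
by apply: contraL v2; apply: branch_sibling b1 b2 n12.
Qed.

Lemma branch_leaves x y D : branch x y D -> 0 < size (leaves D).
Proof.
elim=> {x y D} [x y ly tyx|x y D1 D2 ly tyx b1 u1 b2 u2].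
  by rewrite /leaves /= ly.
by rewrite leaves_node // size_cat addn_gt0 u1.
Qed.

Lemma branch_one_leaf x y D : branch x y D -> size (leaves D) = 1 ->
  verts D = [set y].
Proof.
case=> {x y D} [x y ly tyx|x y D1 D2 ly tyx b1 b2]; first by rewrite verts_leaf.
rewrite leaves_node // size_cat.
move: (branch_leaves b1) (branch_leaves b2).
by case: (size _) (size _) => [|m] [|n] //; rewrite addSn addnS.
Qed.

(** No tree edge leaves the union of the two opposite branches, and the tree is connected. *)
Lemma branch_cover x y D D' v : branch x y D -> branch y x D' ->
  (v \in verts D') = (v \notin verts D).
Proof.
move=> b b'; apply/idP/idP => [h|/negPf nv]; first exact: branch_opposite b' b h.
have step w z : w \in verts D :|: verts D' -> t w z ->
    z \in verts D :|: verts D'.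
  rewrite !in_setU => /orP[] h twz.
    have [->|[_ ->]] := branch_closed b h twz; first by [].
    by rewrite (branch_root b') orbT.
  have [->|[_ ->]] := branch_closed b' h twz; first by rewrite orbT.
  by rewrite (branch_root b).
have clo p w : path t w p -> w \in verts D :|: verts D' ->
    last w p \in verts D :|: verts D'.
  elim: p w => [|z p IH] w //= /andP[twz pth] h; exact: IH pth (step _ _ h twz).
have /connectP[p pth Ev] : connect t y v by case: t_tree.
by have := clo p y pth; rewrite -Ev !in_setU (branch_root b) nv; apply.
Qed.

End Branches.

(** * Branches as pieces of the graph, with [nx] the successor on the outer cycle *)

Section BranchPole.

Variables (V : finType) (e t : rel V) (rot : V -> {perm V}) (nx : V -> V).
Hypotheses (e_sym : symmetric e) (e_irr : irreflexive e).
Hypothesis e_cubic : forall v, degree e v = 3.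
Hypothesis t_tree : is_tree t.
Hypothesis rotP : rotation_system t rot.
Hypothesis e_inner : forall v w, ~~ leaf t v -> e v w = t v w.
Hypothesis e_leaf : forall v w, leaf t v ->
  e v w = [|| t v w, nx v == w | nx w == v].
Hypothesis nx_inj : injective nx.

Lemma inner_cubic v : ~~ leaf t v -> degree t v = 3.
Proof.
move=> nl; rewrite -(e_cubic v); apply: eq_card => w.
by rewrite !inE e_inner.
Qed.

(** Here [l] and [r] are meant to be the leaves just before and just after those of the branch on
    the outer cycle. *)
Definition branch_pole (x y l r : V) (D : seq (V * V)) : pole V :=
  Pole (verts D) (x, y) (l, head y (leaves t D)) (r, last y (leaves t D)).

Lemma wf_leaf_pole x y l r : leaf t y -> t y x ->
  nx l = y -> nx y = r -> l != y -> r != y ->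
  wf e true (Pole [set y] (x, y) (l, y) (r, y)).
Proof.
move=> ly tyx El Er nly nry.
have [_ N] := rot_leaf rotP ly tyx.
have Ne z : e y z = (z \in [:: x; l; r]).
  rewrite e_leaf // N !inE [nx y == z]eq_sym Er -El (inj_eq nx_inj).
  by rewrite [(z == r) || _]orbC.
have xy : x != y by apply/eqP => E; move: tyx; rewrite E; case: t_tree => _ ->.
(* The three listed vertices are all neighbours of [y], which has degree 3, so they are distinct. *)
have U : uniq [:: x; l; r].
  apply/card_uniqP; rewrite -[size _]/3 -(e_cubic y); apply: eq_card => z.
  by rewrite [RHS]inE Ne.
split=> //=.
- by move=> d /(@dartP _ (Pole [set y] (x, y) (l, y) (r, y)))[] -> /=;
  split; rewrite ?inE ?eqxx // e_sym Ne !inE eqxx ?orbT.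
- move=> u v; rewrite inE => /eqP -> _; rewrite e_sym Ne !inE.
  by case/or3P => /eqP ->; rewrite eqxx ?orbT.
Qed.

Lemma branch_colorable x y D l r :
  branch t rot x y D -> path (frel nx) l (rcons (leaves t D) r) ->
  l \notin verts D -> r \notin verts D ->
  let P := branch_pole x y l r D in
  wf e (size (leaves t D) == 1) P /\
  forall u, u \in base_states (size (leaves t D)) -> colorable e P u.
Proof.
move=> b; elim: b l r => {x y D} [x y ly tyx|x y D1 D2 ly tyx b1 IH1 b2 IH2] l r.
  rewrite /branch_pole verts_leaf /leaves /= ly /= !inE => /and3P[/eqP El /eqP Er _] nl nr.
  have W := wf_leaf_pole ly tyx El Er nl nr.
  by split=> //; apply: colorable_leaf.
have [_ U N] := rot_node rotP inner_cubic ly tyx.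
have n12 : rot y x != rot y (rot y x).
  by move: U; rewrite /= !inE => /and3P[].
rewrite /branch_pole verts_node leaves_node // rcons_cat cat_path => /andP[p1 p2] nl nr.
have s1 := branch_leaves b1; have s2 := branch_leaves b2.
set L1 := leaves t D1 in p1 p2 s1 *; set L2 := leaves t D2 in p1 p2 s2 *.
have h2 : head y L2 \in L2 by case: (L2) s2 => //= *; apply: mem_head.
have l1 : last y L1 \in L1 by case: (L1) s1 => //= *; apply: mem_last.
(* The poles of the sub-branches have other default leaves than [y]; the lists being nonempty,
   defaults can be exchanged. *)
have E1 z : last z L1 = last y L1 by case: (L1) s1.
have E2 z : head z L2 = head y L2 by case: (L2) s2.
have F1 z : head z L1 = head y (L1 ++ L2) by case: (L1) s1.
have F2 z : last z L2 = last y (L1 ++ L2) by rewrite last_cat; case: (L2) s2.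
have h2D : head y L2 \in verts D2 by move: h2; rewrite mem_leaves => /andP[].
have l1D : last y L1 \in verts D1 by move: l1; rewrite mem_leaves => /andP[].
have dis v : v \in verts D1 -> v \notin verts D2.
  exact: (branch_sibling t_tree rotP inner_cubic b1 b2 n12).
have n21 : rot y (rot y x) != rot y x by rewrite eq_sym.
have dis' v : v \in verts D2 -> v \notin verts D1.
  exact: (branch_sibling t_tree rotP inner_cubic b2 b1 n21).
move: (nl) (nr); rewrite !in_setU1 !in_setU !negb_or => /and3P[_ nl1 nl2] /and3P[_ nr1 nr2].
(* On the outer cycle the leaves of [D2] directly follow those of [D1], so each sub-branch finds an
   outer end in the other. *)
have [] := IH1 l (head y L2) _ nl1 (dis' _ h2D).
  by rewrite rcons_path p1 E1 /=; move: p2; case: (L2) s2 => //= a s _ /andP[]; rewrite E1.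
rewrite -/L1 => W1 C1.
have [] := IH2 (last y L1) r _ (dis _ l1D) nr2.
  by rewrite -(E1 l).
rewrite -/L2 => W2 C2.
move: W1 W2 C1 C2; rewrite /branch_pole -/L1 -/L2 E1 E2 F1 F2 => W1 W2 C1 C2.
have xD : x \notin verts ((y, rot y x) :: D1 ++ (y, rot y (rot y x)) :: D2 ++ [:: (y, x)]).
  exact: (branch_out t_tree rotP inner_cubic (Branch_node ly tyx b1 b2)).
rewrite verts_node in xD.
have Ny z : e y z = (z \in [:: x; rot y x; rot y (rot y x)]) by rewrite e_inner // N.
have nsz : (size (L1 ++ L2) == 1) = false.
  by rewrite size_cat; case: (size L1) (size L2) s1 s2 => [|m] [|n] //; rewrite addSn addnS.
rewrite nsz; split; first exact: (wf_node e_sym W1 W2).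
move=> u; rewrite size_cat => /(node_states s1 s2)[u1 [u2 [m1 m2 ck]]].
apply: (colorable_node e_sym e_irr W1 W2 _ _ _ dis _ _ _ _ U ck) => //.
  exact: colorable_all m1.
exact: colorable_all m2.
Qed.

End BranchPole.

(* The seams are where [s1] meets [s2] and, cyclically, where [s2] meets [s1]. *)
Lemma fcycle_seams (V : eqType) (f : V -> V) (s1 s2 : seq V) (z : V) :
  fcycle f (s1 ++ s2) -> 0 < size s1 -> 0 < size s2 ->
  fpath f (last z s2) (rcons s1 (head z s2)).
Proof.
case: s1 s2 => [|a s1] [|b s2] //= + _ _.
rewrite rcons_cat cat_path /= rcons_path.
by case/and4P=> p1 /= l1 _ /= l2; rewrite l2 rcons_path p1 /= l1.
Qed.

(** * The cyclic order of the leaves from two opposite branches *)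

Section Boundary.

Variables (V : finType) (t : rel V) (rot : V -> {perm V}).
Hypothesis t_tree : is_tree t.
Hypothesis rotP : rotation_system t rot.
Hypothesis t_cubic : forall v, ~~ leaf t v -> degree t v = 3.

(** The walks along the two branches together run once around the only face. *)
Lemma leaf_order_rot x y D D' : branch t rot x y D -> branch t rot y x D' ->
  uniq (leaves t D ++ leaves t D') /\
  exists n, leaf_order t rot (x, y) = rotr n (leaves t D ++ leaves t D').
Proof.
move=> b b'.
have U : uniq (leaves t D ++ leaves t D').
  rewrite cat_uniq (branch_leaves_uniq t_tree rotP t_cubic b).
  rewrite (branch_leaves_uniq t_tree rotP t_cubic b') andbT.
  apply/hasPn => v; rewrite !mem_leaves => /andP[_ vD']; rewrite negb_and.
  by rewrite (branch_opposite t_tree rotP t_cubic b' b vD') orbT.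
split=> //.
have [p1 l1] := branch_path rotP t_cubic b.
have [p2 l2] := branch_path rotP t_cubic b'.
have u1 := branch_uniq t_tree rotP t_cubic b.
have u2 := branch_uniq t_tree rotP t_cubic b'.
have uD : uniq (D ++ D').
  rewrite cat_uniq u1 u2 andbT; apply/hasPn => -[a c] /mem_verts h.
  by apply: contra (branch_opposite t_tree rotP t_cubic b' b h) => /mem_verts.
(* The dart [(x, y)] ends [D'] but begins the orbit. *)
have [D2 E2] : exists D2, D' = rcons D2 (x, y).
  have := branch_leaves b'.
  case: (D') l2 => [|d s] //= l2 _; exists (belast d s).
  by rewrite lastI l2.
subst D'.
have O : orbit (face_step rot) (x, y) = (x, y) :: D ++ D2.
  rewrite -(@undup_cycle_cons _ _ _ (D ++ D2)).
    by rewrite undup_id // -rotr1_rcons rotr_uniq -cats1 -catA cats1.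
  by rewrite /= -cats1 -catA cats1 cat_path p1 l1.
rewrite /leaf_order O /=.
have E : leaves t D ++ leaves t (rcons D2 (x, y)) =
   leaves t (D ++ D2) ++ (if leaf t x then [:: x] else [::]).
  by rewrite /leaves !map_cat map_rcons filter_rcons filter_cat /=; case: ifP;
     rewrite -?cats1 ?catA ?cats0.
(* Moving that dart to the front rotates the list of leaves by one if [x] is a leaf, and by nothing
   otherwise. *)
rewrite E; case: ifP => lx; last by exists 0; rewrite cats0 /rotr subn0 rot_size.
by exists 1; rewrite cats1 rotr1_rcons.
Qed.

End Boundary.

(** * Colouring cubic Halin graphs *)

Section Halin.

Variable G : sgraph.
Hypotheses (G_cubic : cubic G) (G_halin : halin G).

(** Cutting the tree edge where the boundary walk starts gives two complementary branches with
    matching dangling edges, which [close_states] fits together. *)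
Lemma halin_coloring : exists c : G -> G -> nat,
  [/\ coloring c, proper_on (@adj G) [set: G] c & star_on (@adj G) [set: G] c].
Proof.
have [t [rot [[x y] [[t_tree rotP /= txy] [G4 _ adjE]]]]] := G_halin.
have [t_sym t_irr _ _] := t_tree.
have inner v w : ~~ leaf t v -> adj v w = t v w.
  move=> nl; rewrite adjE /cycle_adj mem_filter (negPf nl) /=.
  by rewrite orbF.
have t_cubic := inner_cubic G_cubic inner.
have tyx : t y x by rewrite t_sym.
have [D b] := branch_exists t_tree rotP t_cubic tyx.
have [D' b'] := branch_exists t_tree rotP t_cubic txy.
have [U [n C0E]] := leaf_order_rot t_tree rotP t_cubic b b'.
set C := leaves t D ++ leaves t D' in U C0E.
have memC v : leaf t v -> v \in C.
  move=> lv; rewrite mem_cat !mem_leaves lv.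
  by rewrite (branch_cover t_tree rotP t_cubic v b b') /= orbN.
have outer v w : leaf t v -> adj v w = [|| t v w, next C v == w | next C w == v].
  move=> /memC vC; rewrite adjE C0E /cycle_adj !mem_rotr !next_rotr // vC /=.
  congr (_ || _); apply: andb_idl => /orP[] /eqP E; first by rewrite -E mem_next.
  by rewrite -(mem_next C) E.
have nx_inj : injective (next C) := can_inj (prev_next U).
have col := branch_colorable (@adj_sym G) (@adj_irrefl G) G_cubic t_tree rotP inner outer nx_inj.
have s1 := branch_leaves b; have s2 := branch_leaves b'.
have C1 : fcycle (next C) (leaves t D ++ leaves t D') := cycle_next U.
have C2 : fcycle (next C) (leaves t D' ++ leaves t D).
  by rewrite -(rot_cycle (size (leaves t D))) rot_size_cat in C1.
have in1 z : head z (leaves t D) \in verts D /\ last z (leaves t D) \in verts D.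
  have [] : head z (leaves t D) \in leaves t D /\ last z (leaves t D) \in leaves t D.
    by case: (leaves t D) s1 => //= a s _; rewrite mem_head mem_last.
  by rewrite !mem_leaves => /andP[_ ->] /andP[_ ->].
have in2 z : head z (leaves t D') \in verts D' /\ last z (leaves t D') \in verts D'.
  have [] : head z (leaves t D') \in leaves t D' /\ last z (leaves t D') \in leaves t D'.
    by case: (leaves t D') s2 => //= a s _; rewrite mem_head mem_last.
  by rewrite !mem_leaves => /andP[_ ->] /andP[_ ->].
have opp v := @branch_opposite _ _ _ t_tree rotP t_cubic _ _ _ _ v b b'.
have opp' v := @branch_opposite _ _ _ t_tree rotP t_cubic _ _ _ _ v b' b.
have [W1 K1] := col _ _ _ _ _ b (fcycle_seams x C1 s1 s2)
  (opp' _ (proj2 (in2 x))) (opp' _ (proj1 (in2 x))).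
have [W2 K2] := col _ _ _ _ _ b' (fcycle_seams y C2 s2 s1)
  (opp _ (proj2 (in1 y))) (opp _ (proj1 (in1 y))).
(* A branch with one leaf is a single vertex, so two leaves in all would leave [G] with at most two
   vertices. *)
have s12 : 2 < size (leaves t D) + size (leaves t D').
  rewrite ltnNge; apply/negP => le2.
  have [e1 e2] : size (leaves t D) = 1 /\ size (leaves t D') = 1.
    move: s1 s2 le2; case: (size (leaves t D)) (size (leaves t D')) => [|[|m]] [|[|k]] //;
    by rewrite !addSn ?addnS.
  have V2 : [set: G] \subset [set x; y].
    apply/subsetP => v _; have := branch_cover t_tree rotP t_cubic v b b'.
    rewrite (branch_one_leaf b e1) (branch_one_leaf b' e2).
    by rewrite !inE => ->; rewrite orNb.
  have := subset_leq_card V2; rewrite cardsT cards2 => /(leq_trans G4).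
  by case: (x != y).
have [u1 [u2 [m1 m2 ck]]] := close_states s1 s2 s12.
apply: (colorable_close (@adj_sym G) (@adj_irrefl G) W1 W2 _ _ _ _ ck).
- by move=> v; apply: (branch_cover t_tree rotP t_cubic v b b').
- by [].
- by [].
- by [].
- exact: K1.
- exact: colorable_all K2 _ m2.
Qed.

(** * From colourings of vertex pairs to star edge colourings *)

Lemma set2_eq (a b a' b' : G) : [set a; b] = [set a'; b'] ->
  (a = a' /\ b = b') \/ (a = b' /\ b = a').
Proof.
move=> E; have [ha hb] : a \in [set a'; b'] /\ b \in [set a'; b'].
  by rewrite -E !inE !eqxx orbT.
have [ha' hb'] : a' \in [set a; b] /\ b' \in [set a; b].
  by rewrite E !inE !eqxx orbT.
move: ha hb ha' hb'; rewrite !inE.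
by case/orP=> /eqP-> /orP[]/eqP-> /orP[]/eqP ? /orP[]/eqP ?; subst; auto.
Qed.

Lemma edgeP (f : edge G) : exists a b, adj a b /\ val f = [set a; b].
Proof.
have /imsetP[[a b]] := valP f.
by rewrite inE /= => h E; exists a, b.
Qed.

Lemma edge_adj (f : edge G) a b : val f = [set a; b] -> adj a b.
Proof.
have [a' [b' [h ->]]] := edgeP f.
by case/set2_eq => -[<- <-] //; rewrite adj_sym.
Qed.

Lemma edge_at (f : edge G) z : z \in val f -> exists a, val f = [set a; z].
Proof.
have [a [b [_ ->]]] := edgeP f; rewrite !inE => /orP[] /eqP ->; last by exists a.
by exists b; rewrite setUC.
Qed.

Lemma star_edge_colorable_of (c : G -> G -> nat) :
  coloring c -> proper_on (@adj G) [set: G] c -> star_on (@adj G) [set: G] c ->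
  star_edge_colorable G 6.
Proof.
move=> [csym c6] cp cs.
(* An arbitrary orientation of the edge is picked; by symmetry of [c] the colour does not depend on
   it. *)
pose g (f : edge G) : 'I_6 :=
  if [pick p : G * G | val f == [set p.1; p.2]] is Some p
  then inord (c p.1 p.2) else ord0.
have gE f a b : val f = [set a; b] -> g f = c a b :> nat.
  move=> E; rewrite /g; case: pickP => [[a' b'] /= /eqP|/(_ (a, b))]; last by rewrite /= E eqxx.
  rewrite E inordK // => /set2_eq[] [-> ->] //.
have prop (f f' : edge G) a z b : val f = [set a; z] -> val f' = [set z; b] ->
    a != b -> g f != g f'.
  move=> E E' ab; rewrite -val_eqE /= (gE _ _ _ E) (gE _ _ _ E').
  by apply: cp; rewrite ?inE // ; [apply: edge_adj E | apply: edge_adj E'].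
have star (f1 f2 f3 f4 : edge G) x0 x1 x2 x3 x4 :
    val f1 = [set x0; x1] -> val f2 = [set x1; x2] ->
    val f3 = [set x2; x3] -> val f4 = [set x3; x4] ->
    x0 != x2 -> x1 != x3 -> x2 != x4 ->
    2 < #|[set g f1; g f2; g f3; g f4]|.
  move=> E1 E2 E3 E4 n0 n1 n2; rewrite ltnNge; apply/negP => le2.
  have p12 := prop _ _ _ _ _ E1 E2 n0.
  have p23 := prop _ _ _ _ _ E2 E3 n1.
  have p34 := prop _ _ _ _ _ E3 E4 n2.
  (* With two colours only, properness forces them to alternate along the walk, which [star_on]
     forbids. *)
  have Es : [set g f1; g f2] = [set g f1; g f2; g f3; g f4].
    by apply/eqP; rewrite eqEcard cards2 p12 le2 andbT -setUA subsetUl.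
  have h3 : g f3 \in [set g f1; g f2] by rewrite Es !inE eqxx !orbT.
  have h4 : g f4 \in [set g f1; g f2] by rewrite Es !inE eqxx !orbT.
  move: h3; rewrite !inE eq_sym [_ == g f2]eq_sym (negPf p23) orbF => /eqP e13.
  move: h4; rewrite !inE eq_sym e13 (negPf p34) /= => /eqP e24.
  have := cs x0 x1 x2 x3 x4; rewrite !inE => /(_ isT isT isT).
  move=> /(_ (edge_adj E1) (edge_adj E2) (edge_adj E3) (edge_adj E4) n0 n1 n2).
  by rewrite -(gE _ _ _ E1) -(gE _ _ _ E2) -(gE _ _ _ E3) -(gE _ _ _ E4) e13 e24; apply.
apply/existsP; exists [ffun f => g f]; apply/andP; split.
  apply/forallP => f; apply/forallP => f'; apply/implyP => /andP[nff'].
  case/set0Pn => z; rewrite inE => /andP[zf zf'].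
  have [a E] := edge_at zf; have [b E'] := edge_at zf'; rewrite !ffunE.
  apply: (prop _ _ a z b) => //; first by rewrite E' setUC.
  apply: contraNneq nff' => ab; apply/eqP/val_inj.
  by rewrite E E' ab.
apply/forallP => f1; apply/forallP => f2; apply/forallP => f3.
apply/forallP => f4; apply/implyP; rewrite !ffunE -ltnNge => /orP[].
  case/existsP=> x0 /existsP[x1 /existsP[x2 /existsP[x3 /existsP[x4]]]].
  case/andP=> U /and4P[/eqP E1 /eqP E2 /eqP E3 /eqP E4].
  move: U; rewrite /= !inE !negb_or => /and4P[/and4P[_ n02 _ _] /and3P[_ n13 _] /andP[_ n24] _].
  exact: star E1 E2 E3 E4 n02 n13 n24.
case/existsP=> x0 /existsP[x1 /existsP[x2 /existsP[x3]]].
case/andP=> U /and4P[/eqP E1 /eqP E2 /eqP E3 /eqP E4].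
move: U; rewrite /= !inE !negb_or => /and4P[/and3P[_ n02 _] /andP[_ n13] _ _].
(* For a 4-cycle [x4] is [x0], and the last inequality is the first one reversed. *)
by apply: (star _ _ _ _ _ _ _ _ _ E1 E2 E3 E4 n02 n13); rewrite eq_sym.
Qed.

End Halin.

Theorem theorem13 (G : sgraph) (cubicG : cubic G) (halinG : halin G) :
  star_chromatic_index G <= 6.
Proof.
have [c [cc cp cs]] := halin_coloring cubicG halinG.
rewrite /star_chromatic_index; case: ex_minnP => m _; apply.
exact: star_edge_colorable_of cc cp cs.
Qed.
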